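(* Let $s\ge 3$ be an integer, $\gamma>0$, and let $G$ be a $(2s,\gamma)$-good graph on $n$ vertices. Then \[ w\text{-}sat(G,K_s)=(s-2)n-\binom{s-1}{2}. \]
   Context: Given a graph $G$ and a vertex set $X$, a clique extension of $X$ is a vertex set $Y$ disjoint from $X$ such that $G[Y]$ is a clique and every vertex of $X$ is adjacent to every vertex of $Y$; its size is $|Y|$. A graph $G$ on $n$ vertices is $(t,\gamma)$-good if: (P1) for any vertex set $X$ of size $x$ and any integer $y$ with $x,y\le t$, $G$ contains at least $\gamma n$ pairwise disjoint clique extensions of $X$ of size $y$; and (P2) for any two disjoint vertex sets $S$ and $T$ each of size at least $\gamma n/2$, there is a vertex $v\in T$ and a set $X\subseteq S$ of size $t-1$ such that $X\cup\{v\}$ induces a clique in $G$. $K_s$ is the complete graph on $s$ vertices. A subgraph $H\subseteq G$ is weakly $K_s$-saturated in $G$ if $H$ contains no copy of $K_s$, but the edges of $G$ missing from $H$ can be added one by one in some order so that each added edge creates a new copy of $K_s$; $w\text{-}sat(G,K_s)$ is the minimum number of edges of such an $H$. *)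

(* Defs.v *)
From HB Require Import structures.
From mathcomp Require Import all_boot all_order all_algebra.
From mathcomp Require Import reals.

Set Implicit Arguments.
Unset Strict Implicit.
Unset Printing Implicit Defensive.

Import Order.TTheory GRing.Theory Num.Theory.

Section Graphs.

Variable V : finType.

Definition clique (e : rel V) (K : {set V}) : bool :=
  [forall x in K, forall y in K, (x != y) ==> e x y].

Definition clique_extension (e : rel V) (X Y : {set V}) : bool :=
  [&& [disjoint X & Y], clique e Y & [forall x in X, forall y in Y, e x y]].

Definition edges (e : rel V) : {set {set V}} :=
  [set [set p.1; p.2] | p : V * V & e p.1 p.2].

(* A subgraph H of G is given by its edge set F, a subset of edges G; its
   vertex set is all of V, as isolated vertices affect neither the copies of
   K_s (s >= 2) nor the number of edges. *)
Definition edge_rel (F : {set {set V}}) : rel V :=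
  fun x y => [set x; y] \in F.

(* A copy of K_s in a graph is determined by its vertex set. *)
Definition copyK (s : nat) (F : {set {set V}}) (K : {set V}) : bool :=
  (#|K| == s) && clique (edge_rel F) K.

Definition K_free (s : nat) (F : {set {set V}}) : bool :=
  [forall K : {set V}, ~~ copyK s F K].

Definition creates_copyK (s : nat) (F : {set {set V}}) (f : {set V}) : bool :=
  [exists K : {set V}, copyK s (f |: F) K && ~~ copyK s F K].

Fixpoint saturating_order (s : nat) (F : {set {set V}}) (r : seq {set V})
    : bool :=
  if r is f :: r' then creates_copyK s F f && saturating_order s (f |: F) r'
  else true.

Definition completable (s : nat) (e : rel V) (F : {set {set V}}) : bool :=
  has (saturating_order s F) (permutations (enum (edges e :\: F))).

Definition weakly_saturated (s : nat) (e : rel V) (F : {set {set V}}) : bool :=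
  [&& F \subset edges e, K_free s F & completable s e F].

(* The default value #|edges e| of the minimum is harmless: it bounds #|F| for
   every F \subset edges e, and the minimum is over a nonempty family for
   s >= 2; see wsat_attained and wsat_le. *)
Definition wsat (e : rel V) (s : nat) : nat :=
  \big[minn/#|edges e|]_(F : {set {set V}} | weakly_saturated s e F) #|F|.

Lemma wsat_le (e : rel V) (s : nat) (F : {set {set V}}) :
  weakly_saturated s e F -> wsat e s <= #|F|.
Proof.
move=> wF; rewrite /wsat.
have : F \in index_enum {set {set V}} by rewrite mem_index_enum.
elim: (index_enum _) => // G r IHr; rewrite inE big_cons => /predU1P[<-|/IHr leF].
  by rewrite wF geq_minl.
by case: ifP => // _; rewrite geq_min leF orbT.
Qed.

Lemma weakly_saturated_exists (e : rel V) (s : nat) :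
  2 <= s -> exists F, weakly_saturated s e F.
Proof.
move=> s2.
suff H n (F : {set {set V}}) : #|F| <= n -> F \subset edges e ->
    completable s e F -> exists F, weakly_saturated s e F.
  apply: (H _ (edges e) (leqnn _)) => //.
  by apply/hasP; exists [::]; rewrite // mem_permutations setDv enum_set0.
elim: n F => [|n IHn] F leFn sF cF; last first.
  have [free|/forallPn [K]] := boolP (K_free s F).
    by exists F; rewrite /weakly_saturated sF free cF.
  rewrite negbK => cK; have /andP[/eqP sK clK] := cK.
  have /card_gt1P [x [y [xK yK xy]]] : 1 < #|K| by rewrite sK.
  pose f := [set x; y].
  have fF : f \in F.
    by move/forall_inP/(_ x xK)/forall_inP/(_ y yK)/implyP/(_ xy): clK.
  apply: (IHn (F :\ f)).
  - by move: leFn; rewrite (cardsD1 f) fF.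
  - exact: subset_trans (subsetDl _ _) sF.
  - have /hasP [r] := cF; rewrite mem_permutations => pr or.
    apply/hasP; exists (f :: r).
      rewrite mem_permutations uniq_perm ?enum_uniq //=.
        rewrite (perm_uniq pr) enum_uniq andbT (perm_mem pr) mem_enum.
        by rewrite inE fF.
      move=> g; rewrite inE (perm_mem pr) !mem_enum !inE.
      case: (altP (g =P f)) => [->|gf] //=.
      by rewrite (subsetP sF _ fF).
    rewrite /= setD1K // or andbT; apply/existsP; exists K.
    rewrite setD1K // cK /=; apply/negP => /andP[_].
    move/forall_inP/(_ x xK)/forall_inP/(_ y yK)/implyP/(_ xy).
    by rewrite /edge_rel !inE eqxx.
have F0 : F = set0 by apply/eqP; rewrite -cards_eq0 -leqn0.
exists F; rewrite /weakly_saturated sF cF andbT /=.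
apply/forallP => K; apply/negP => /andP[/eqP sK].
have /card_gt1P [x [y [xK yK xy]]] : 1 < #|K| by rewrite sK.
move/forall_inP/(_ x xK)/forall_inP/(_ y yK)/implyP/(_ xy).
by rewrite /edge_rel F0 inE.
Qed.

Lemma wsat_attained (e : rel V) (s : nat) :
  2 <= s -> exists2 F, weakly_saturated s e F & wsat e s = #|F|.
Proof.
move=> s2; have [F0 wF0] := weakly_saturated_exists e s2.
have [F wF minF] := arg_minnP (fun F : {set {set V}} => #|F|) wF0.
exists F => //; apply/eqP; rewrite eqn_leq wsat_le //=.
rewrite /wsat; elim/big_ind: _ => [|a b la lb|]; last exact: minF.
  by have /and3P[/subset_leq_card] := wF.
by rewrite leq_min la.
Qed.

Local Open Scope ring_scope.

(* The disjoint clique extensions form a family indexed by 'I_k rather than a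
   set of sets, so that the case y = 0 imposes nothing. *)
Definition good (R : realType) (t : nat) (gamma : R) (e : rel V) : Prop :=
  (forall (X : {set V}) (y : nat), (#|X| <= t)%N -> (y <= t)%N ->
     exists (k : nat) (Y : 'I_k -> {set V}),
       [/\ gamma * #|V|%:R <= k%:R,
           forall i, #|Y i| = y /\ clique_extension e X (Y i) &
           forall i j, i != j -> [disjoint Y i & Y j]])
  /\
  (forall S T : {set V}, [disjoint S & T] ->
     gamma * #|V|%:R / 2 <= #|S|%:R -> gamma * #|V|%:R / 2 <= #|T|%:R ->
     exists (v : V) (X : {set V}),
       [/\ v \in T, X \subset S, #|X| = t.-1 & clique e (v |: X)]).

End Graphs.

(* Main.v *)
(** Put d = s - 2.  Upper bound: fix a d-clique C with common neighbourhood N.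
    Join the vertices of N to C, and every other vertex v to a d-clique of
    N(v) inside N.  The edges inside C + N come first; clique extensions of
    sets containing C lie in N, so they provide the cliques that complete the
    remaining edges.

    Lower bound: attach distinct numbers t_x to the vertices.  For polynomials
    f_x of degree less than d, the equations f_x(t_y) = f_y(t_x) for all pairs
    of a K_s but one imply the last one, by interpolation at the other d
    vertices.  Hence the equations of a weakly saturated F imply those of G, and
    then all of them since every nonedge of G completes a K_s.  All equations
    together with the vanishing of f_x(t_y) for the C(d+1,2) unordered pairs
    (x = y allowed) from a fixed d-set force f = 0, so |F| + C(d+1,2) is at
    least the dimension d n of the space of families (f_x). *)
Require Import Defs.
From HB Require Import structures.
From mathcomp Require Import all_boot all_order all_algebra.
From mathcomp Require Import reals zify.

Set Implicit Arguments.
Unset Strict Implicit.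
Unset Printing Implicit Defensive.

Import Order.TTheory GRing.Theory Num.Theory.

(** * Weak saturation through closed edge sets *)

Definition saturation_closed (V : finType) (s : nat) (e : rel V)
    (H : {set {set V}}) : Prop :=
  forall f, f \in edges e -> creates_copyK s H f -> f \in H.

(** [Y] stands for the [d] = s - 2 vertices of a K_s other than the ends of its last edge. The
    relation [r] is arbitrary, so that the notion applies both to edge sets and to the polynomial
    equations. *)
Definition near_clique_closed (V : finType) (d : nat) (e r : rel V) : Prop :=
  forall (Y : {set V}) u w, e u w -> #|Y| = d -> clique r Y ->
    u \notin Y -> w \notin Y -> u != w ->
    {in Y, forall y, r u y} -> {in Y, forall y, r w y} -> r u w.

Lemma cliqueP (V : finType) (e : rel V) (K : {set V}) :
  reflect {in K &, forall x y, x != y -> e x y} (clique e K).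
Proof.
apply: (iffP forall_inP) => [cK x y xK yK|cK x xK].
  by move/forall_inP/(_ y yK)/implyP: (cK x xK).
by apply/forall_inP => y yK; apply/implyP; apply: cK.
Qed.

Lemma clique_extensionP (V : finType) (e : rel V) (X Y : {set V}) :
  reflect [/\ [disjoint X & Y], clique e Y & {in X & Y, forall x y, e x y}]
          (clique_extension e X Y).
Proof.
apply: (iffP and3P) => -[dXY cY h]; split=> //.
  by move=> x y xX yY; move/forall_inP/(_ x xX)/forall_inP/(_ y yY): h.
by apply/forall_inP => x xX; apply/forall_inP => y yY; apply: h.
Qed.

Lemma edge_relC (V : finType) (F : {set {set V}}) : symmetric (edge_rel F).
Proof. by move=> x y; rewrite /edge_rel setUC. Qed.

Lemma eq_set2 (V : finType) (a b x y : V) :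
  [set a; b] = [set x; y] -> (a = x /\ b = y) \/ (a = y /\ b = x).
Proof.
move=> E.
have: a \in [set x; y] by rewrite -E set21.
have: b \in [set x; y] by rewrite -E set22.
have: x \in [set a; b] by rewrite E set21.
have: y \in [set a; b] by rewrite E set22.
rewrite !inE => /orP[]/eqP E1 /orP[]/eqP E2 /orP[]/eqP E3 /orP[]/eqP E4;
  subst; by [left|right].
Qed.

Lemma edgesP (V : finType) (e : rel V) (f : {set V}) :
  reflect (exists u w, e u w /\ f = [set u; w]) (f \in edges e).
Proof.
apply: (iffP imsetP) => [[[u w]]|[u [w [euw ->]]]].
  by rewrite inE /= => euw ->; exists u, w.
by exists (u, w); rewrite ?inE.
Qed.

Lemma edge_rel_edges (V : finType) (e : rel V) :
  symmetric e -> edge_rel (edges e) =2 e.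
Proof.
move=> e_sym x y; apply/idP/idP => [/edgesP[u [w [euw]]]|exy].
  by case/eq_set2 => -[-> ->]; rewrite // e_sym.
by apply/edgesP; exists x, y.
Qed.

Lemma new_copyK_endpoints (V : finType) (s : nat) (F : {set {set V}})
    (f K : {set V}) :
  copyK s (f |: F) K -> ~~ copyK s F K ->
  exists x y, [/\ x \in K, y \in K, x != y & f = [set x; y]].
Proof.
move=> /andP[cK /cliqueP cl]; rewrite /copyK cK /= => /forall_inPn[x xK].
case/forall_inPn => y yK; rewrite negb_imply => /andP[xy nF]; exists x, y.
split=> //; move: (cl x y xK yK xy) nF; rewrite /edge_rel in_setU1.
by case/predU1P => [->|->].
Qed.

(** The new copy contains both ends of [f], so it stays incomplete in [H] as long as [f] is
    missing. *)
Lemma creates_copyK_sub (V : finType) (s : nat) (F H : {set {set V}}) f :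
  F \subset H -> creates_copyK s F f -> f \notin H -> creates_copyK s H f.
Proof.
move=> sFH /existsP[K /andP[cK ncK]] fH.
have [x [y [xK yK xy fxy]]] := new_copyK_endpoints cK ncK.
apply/existsP; exists K; apply/andP; split.
  have /andP[cdK /cliqueP cl] := cK; rewrite /copyK cdK.
  apply/cliqueP => a b aK bK ab.
  exact: subsetP (setUS _ sFH) _ (cl a b aK bK ab).
apply: contra fH => /andP[_ /cliqueP cl]; rewrite fxy; exact: cl.
Qed.

(** Along the saturating order the current edge set never leaves [H]. *)
Lemma closed_completable (V : finType) (s : nat) (e : rel V)
    (F H : {set {set V}}) :
  completable s e F -> F \subset H -> saturation_closed s e H ->
  edges e \subset H.
Proof.
move=> /hasP[r]; rewrite mem_permutations => pr or sFH cH.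
have re : {subset r <= edges e}.
  by move=> f; rewrite (perm_mem pr) mem_enum inE => /andP[].
have {pr} er : {subset edges e <= F :|: [set:: r]}.
  by move=> f fe; rewrite !inE (perm_mem pr) mem_enum inE fe andbT orbN.
suff sr : {subset r <= H}.
  by apply/subsetP => f /er; rewrite !inE => /orP[/(subsetP sFH)|/sr].
elim: r F sFH or re {er} => //= f r IHr F sFH /andP[cf or] re.
have fH : f \in H.
  apply: contraT => fH; rewrite -(negbTE fH);
    apply: (cH f (re f (mem_head _ _))).
  exact: creates_copyK_sub cf fH.
have sH := IHr (f |: F) _ or (fun g gr => re g (mem_behead (s := f :: r) gr)).
by move=> g; rewrite inE => /predU1P[->|/sH->] //; rewrite subUset sub1set fH.
Qed.

(** Greedy choice: if edges are missing from [F], then [F] itself is not closed, so some missing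
    edge creates a copy and can come next. The hypothesis passes to larger sets. *)
Lemma completable_closed (V : finType) (s : nat) (e : rel V)
    (F : {set {set V}}) :
  (forall H : {set {set V}}, F \subset H -> saturation_closed s e H ->
     edges e \subset H) ->
  completable s e F.
Proof.
have [n] := ubnP #|edges e :\: F|; elim: n F => // n IHn F ltn clF.
have [sF|nsF] := boolP (edges e \subset F).
  by apply/hasP; exists [::] => //; move: sF;
    rewrite -setD_eq0 mem_permutations => /eqP->; rewrite enum_set0.
have [f /andP[fe fF] cf] :
    exists2 f, (f \in edges e) && (f \notin F) & creates_copyK s F f.
  have [/existsP[f /andP[? ?]]|/existsPn h] :=
    boolP [exists f, ((f \in edges e) && (f \notin F)) && creates_copyK s F f].
    by exists f.
  case/negP: nsF; apply: clF => // f fe cf; move: (h f).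
  by rewrite fe cf andbT negbK.
have /hasP[r] : completable s e (f |: F).
  apply: IHn => [|H]; last by rewrite subUset => /andP[_]; apply: clF.
  apply: leq_trans (ltn : _ <= n); apply: proper_card.
  apply/properP; split; first by rewrite setDS // subsetUr.
  by exists f; rewrite !inE ?fF ?fe ?eqxx.
rewrite mem_permutations => pr or; apply/hasP; exists (f :: r); last
  by rewrite /= cf.
rewrite mem_permutations uniq_perm ?enum_uniq //=.
  by rewrite (perm_uniq pr) enum_uniq (perm_mem pr) mem_enum !inE eqxx.
move=> g; rewrite inE (perm_mem pr) !mem_enum !inE.
by case: eqVneq => [->|//]; rewrite fF.
Qed.

Lemma near_clique_closedP (V : finType) (d : nat) (e : rel V)
    (H : {set {set V}}) :
  saturation_closed d.+2 e H <-> near_clique_closed d e (edge_rel H).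
Proof.
split=> [cH Y u w euw cY /cliqueP clY uY wY uw uH wH|cH f].
  apply: contraT => fH; rewrite -(negbTE fH).
  apply: cH; first by apply/edgesP; exists u, w.
  apply/existsP; exists (u |: (w |: Y)); apply/andP; split.
    rewrite /copyK !cardsU1 cY !inE negb_or uw uY wY eqxx.
    apply/cliqueP => x y; rewrite /edge_rel in_setU1.
    rewrite !in_setU1 => /predU1P[->|/predU1P[->|xY]]
      /predU1P[->|/predU1P[->|yY]];
      rewrite ?eqxx //; move=> xy.
    - by apply/orP; right; apply: uH.
    - by rewrite setUC eqxx.
    - by apply/orP; right; apply: wH.
    - by apply/orP; right; rewrite -/(edge_rel H x u) edge_relC; apply: uH.
    - by apply/orP; right; rewrite -/(edge_rel H x w) edge_relC; apply: wH.
    - by apply/orP; right; apply: clY.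
  apply: contra fH => /andP[_ /cliqueP]; apply=> //; rewrite !inE eqxx ?orbT //.
move=> /edgesP[u [w [euw ->]]] /existsP[K /andP[cK ncK]].
have [x [y [xK yK xy fxy]]] := new_copyK_endpoints cK ncK.
have {x y xK yK xy fxy} [uK wK uw] : [/\ u \in K, w \in K & u != w].
  by case: (eq_set2 fxy) => -[-> ->]; split=> //; rewrite eq_sym.
have /andP[/eqP cdK /cliqueP cl] := cK.
have inH a b : a \in K -> b \in K -> a != b -> a \notin [set u;
  w] -> edge_rel H a b.
  move=> aK bK ab auw; have := cl a b aK bK ab; rewrite /edge_rel in_setU1.
  by case/predU1P=> // E; move: auw; rewrite -E set21.
apply: (cH (K :\ u :\ w)) => //.
- by have := cardsD1 u K;
    rewrite uK cdK (cardsD1 w (K :\ u)) !inE eq_sym uw wK; case.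
- apply/cliqueP => a b; rewrite !inE => /and3P[aw au aK] /and3P[bw bu bK] ab.
  by apply: inH; rewrite // !inE negb_or au.
- by rewrite !inE eqxx andbF.
- by rewrite !inE eqxx.
- move=> y; rewrite !inE => /and3P[yw yu yK]; rewrite edge_relC.
  by apply: inH; rewrite // !inE negb_or yu.
- move=> y; rewrite !inE => /and3P[yw yu yK]; rewrite edge_relC.
  by apply: inH; rewrite // !inE negb_or yu.
Qed.

(* A completable edge set of minimum size is K_s-free: an edge of a copy of K_s
   can be removed, since the copy creates it again. *)
Lemma wsat_le_completable (V : finType) (s : nat) (e : rel V)
    (F : {set {set V}}) :
  2 <= s -> F \subset edges e -> completable s e F -> wsat e s <= #|F|.
Proof.
move=> s2 sF cF.
pose P (F : {set {set V}}) := (F \subset edges e) && completable s e F.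
have PF : P F by rewrite /P sF.
have [G /andP[sG cG] minG] := arg_minnP (fun F : {set {set V}} => #|F|) PF.
apply: leq_trans (minG F PF); apply: wsat_le;
  rewrite /weakly_saturated sG cG andbT.
apply/forallP => K; apply/negP => cK; have /andP[/eqP sK /cliqueP clK] := cK.
have /card_gt1P [x [y [xK yK xy]]] : 1 < #|K| by rewrite sK.
pose f := [set x; y]; have fG : f \in G := clK x y xK yK xy.
suff /minG : P (G :\ f) by rewrite (cardsD1 f G) fG ltnn.
rewrite /P (subset_trans (subsetDl _ _) sG) /=.
apply: completable_closed => H sH cH; apply: (closed_completable cG) => //.
have fH : f \in H.
  apply: contraT => fH; rewrite -(negbTE fH); apply: (cH f (subsetP sG f fG)).
  apply: (creates_copyK_sub sH) => //; apply/existsP; exists K.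
  rewrite setD1K // cK; apply/negP => /andP[_ /cliqueP/(_ x y xK yK xy)].
  by rewrite /edge_rel !inE eqxx.
by rewrite -(setD1K fG) subUset sub1set fH.
Qed.

(** * Upper bound: a small completable edge set *)

Lemma card_core_edges (V : finType) (d : nat) (C : {set V}) (Y : V -> {set V}) :
  #|C| = d -> (forall v, #|Y v| = d) ->
  #|[set f : {set V} | f \subset C & #|f| == 2] :|:
    \bigcup_(v in ~: C) [set [set v; y] | y in Y v]| + 'C(d.+1, 2)
  <= d * #|V|.
Proof.
(* At most C(d,2) edges lie inside [C], and each of the n - d other vertices brings at most d. The
   total is d n because C(d,2) + C(d+1,2) = d^2. *)
move=> cC cY; apply: (@leq_trans ('C(d, 2) + (#|V| - d) * d + 'C(d.+1, 2))).
  rewrite leq_add2r; apply: leq_trans (leq_card_setU _ _) _.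
  have cV : #|~: C| = #|V| - d by rewrite cardsCs setCK cC.
  rewrite cards_draws cC leq_add2l -cV -sum_nat_const;
    apply: (big_rec2 (fun (A : {set {set V}}) m => #|A| <= m)).
    by rewrite cards0.
  move=> v m A _ leA; apply: leq_trans (leq_card_setU _ _) _;
    apply: leq_add => //.
  by apply: leq_trans (leq_imset_card _ _) _; rewrite cY.
have dV : d <= #|V| by rewrite -cC max_card.
have E : 'C(d, 2) + 'C(d.+1, 2) = d * d.
  elim: (d) => // k IH; rewrite [in X in _ + X]binS bin1;
    rewrite binS bin1 in IH *; lia.
rewrite addnAC E mulnC -mulnDr subnKC //.
Qed.

(** The bound 2(d + 1) on [X] leaves room for [C] and d + 2 further vertices: the two ends of an
    edge and the d chosen neighbours of one end. *)
Lemma wsat_upper (V : finType) (d : nat) (e : rel V) :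
  symmetric e -> irreflexive e ->
  (forall X : {set V}, #|X| <= (d.+1).*2 ->
     exists Y : {set V}, #|Y| = d /\ clique_extension e X Y) ->
  wsat e d.+2 + 'C(d.+1, 2) <= d * #|V|.
Proof.
move=> e_sym e_irr ext.
have [C [cC /clique_extensionP[_ clC _]]] := ext set0 ltac:(by rewrite cards0).
pose N := [set v | [forall c in C, e c v]].
have NP v : reflect {in C, forall c, e c v} (v \in N).
  by rewrite inE; apply: forall_inP.
pose good_nbrs v (Y : {set V}) :=
  [&& #|Y| == d, clique e Y, [forall y in Y, e v y] &
  if v \in N then Y == C else Y \subset N].
have exY v : exists Y, good_nbrs v Y.
  have [vN|vN] := boolP (v \in N).
    exists C; rewrite /good_nbrs cC !eqxx clC vN /= andbT.
    by apply/forall_inP => c cC'; rewrite e_sym; apply: (NP v vN).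
  have [|Y [cY /clique_extensionP[_ clY jY]]] := ext (v |: C).
    by rewrite cardsU1 cC; case: (_ \notin _); lia.
  exists Y; rewrite /good_nbrs cY eqxx clY (negbTE vN) /=; apply/andP; split.
    by apply/forall_inP => y yY; apply: jY; rewrite ?setU11.
  by apply/subsetP => y yY; apply/NP => c cC'; apply: jY; rewrite ?setU1r.
pose Y v := xchoose (exY v).
have YP v : good_nbrs v (Y v) := xchooseP (exY v).
have cY v : #|Y v| = d by case/and4P: (YP v) => /eqP.
have clY v : clique e (Y v) by case/and4P: (YP v).
have eY v : {in Y v, forall y, e v y} by case/and4P: (YP v) => _ _ /forall_inP.
have YC v : v \in N -> Y v = C by move=> vN; case/and4P: (YP v);
  rewrite vN => _ _ _ /eqP.
have YN v : v \notin N -> Y v \subset N.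
  by move=> vN; case/and4P: (YP v); rewrite (negbTE vN) => _ _ _.
apply: leq_trans (card_core_edges cC cY); rewrite leq_add2r.
apply: wsat_le_completable => //.
  rewrite subUset; apply/andP; split.
    apply/subsetP => f; rewrite inE => /andP[fC /cards2P[x [y [xy Ef]]]].
    rewrite Ef in fC *; apply/edgesP; exists x, y; split=> //.
    by move/cliqueP: clC; apply=> //; apply: (subsetP fC);
      rewrite !inE eqxx ?orbT.
  apply/bigcupsP => v _; apply/subsetP => f /imsetP[y yY ->].
  by apply/edgesP; exists v, y; split=> //; apply: eY.
apply: completable_closed => H; rewrite subUset => /andP[sC /bigcupsP sY].
move/near_clique_closedP; set r := edge_rel H => cH.
have r_sym : symmetric r := edge_relC H.
have e_neq u w : e u w -> u != w by apply: contraTneq => ->; rewrite e_irr.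
have rC : clique r C.
  apply/cliqueP => x y xC yC xy; apply: (subsetP sC).
  by rewrite inE cards2 xy eqxx subUset !sub1set xC yC.
have rY v : v \notin C -> {in Y v, forall y, r v y}.
  move=> vC y yY; apply: (subsetP (sY v _)); rewrite ?inE //.
  by apply/imsetP; exists y.
have NC v : v \in N -> v \notin C.
  by move=> /NP vN; apply/negP => /vN; rewrite e_irr.
have rNC v c : v \in N -> c \in C -> r v c.
  by move=> vN cC'; apply: rY; rewrite ?YC ?NC.
have rNN u w : u \in N -> w \in N -> e u w -> r u w.
  move=> uN wN euw; apply: (cH C u w) => //; rewrite ?NC ?e_neq //;
  by move=> c cC'; apply: rNC.
have rclN (Z : {set V}) : Z \subset N -> clique e Z -> clique r Z.
  move=> /subsetP ZN /cliqueP clZ; apply/cliqueP => x y xZ yZ xy.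
  by apply: rNN; rewrite ?ZN // clZ.
(* Common neighbours of C lie in N, where all edges are already available. *)
have extN (X : {set V}) : #|X| <= d.+2 -> exists Z : {set V},
    [/\ #|Z| = d, Z \subset N, clique e Z & {in X & Z, forall x z, e x z}].
  move=> leX; have [|Z [cZ /clique_extensionP[_ clZ jZ]]] := ext (C :|: X).
    by apply: leq_trans (leq_card_setU _ _) _; rewrite cC; lia.
  exists Z; split=> //.
    by apply/subsetP => z zZ; apply/NP => c cC'; apply: jZ; rewrite // inE cC'.
  by move=> x z xX zZ; apply: jZ; rewrite // inE xX orbT.
have notin_nbr (Z : {set V}) x : {in Z, forall z, e x z} -> x \notin Z.
  by move=> h; apply/negP => /h; rewrite e_irr.
(* Take a clique [Z] in [N] joined to [u], [v] and [Y v]. The edges from [v] to [Z] are completed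
   over [Y v], and then the edge from [v] to [u] over [Z]. *)
have rvN v u : v \notin C -> v \notin N -> u \in C :|: N -> e u v -> r v u.
  move=> vC vN uCN euv.
  have [|Z [cZ ZN clZ jZ]] := extN (u |: (v |: Y v)).
    by rewrite !cardsU1 cY; case: (_ \notin _); case: (_ \notin _); lia.
  have evZ : {in Z, forall z, e v z} by move=> z zZ; apply: jZ;
    rewrite // !inE eqxx orbT.
  have euZ : {in Z, forall z, e u z} by move=> z zZ; apply: jZ;
    rewrite // !inE eqxx.
  have eYZ : {in Y v & Z, forall y z, e y z}.
    by move=> y z yY zZ; apply: jZ; rewrite // !inE yY !orbT.
  have rYZ : {in Z & Y v, forall z y, r z y}.
    move=> z y zZ yY; rewrite r_sym; apply: rNN; rewrite ?eYZ //.
      exact: (subsetP (YN v vN)).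
    exact: (subsetP ZN).
  have rvZ : {in Z, forall z, r v z}.
    move=> z zZ; apply: (cH (Y v) v z) => //.
    - exact: evZ.
    - by apply: rclN; rewrite ?YN.
    - exact/notin_nbr/eY.
    - by apply: notin_nbr => y yY; rewrite e_sym eYZ.
    - by rewrite e_neq ?evZ.
    - exact: rY.
    - by move=> y; apply: rYZ.
  apply: (cH Z v u) => //; rewrite ?notin_nbr // 1?e_sym //.
  - exact: rclN.
  - by rewrite eq_sym e_neq.
  - move=> z zZ; have zN := subsetP ZN z zZ.
    move: uCN; rewrite inE => /orP[uC|uN]; first by rewrite r_sym rNC.
    by rewrite rNN ?euZ.
suff re : forall u w, e u w -> r u w
  by apply/subsetP => f /edgesP[u [w [/re ruw ->]]].
have rCN u w : u \in C :|: N -> e u w -> r u w.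
  move=> uCN euw; have [wC|wC] := boolP (w \in C).
    move: uCN; rewrite inE => /orP[uC|uN]; last exact: rNC.
    by move/cliqueP: rC; apply; rewrite ?e_neq.
  have [wN|wN] := boolP (w \in N); last by rewrite r_sym rvN.
  move: uCN; rewrite inE => /orP[uC|uN]; first by rewrite r_sym rNC.
  exact: rNN.
move=> u w euw.
(* What remains are edges with both ends outside [C] and [N]; they are completed over a clique of
   common neighbours in [N], to which both ends are already joined. *)
have [|uCN] := boolP (u \in C :|: N); first by move/rCN; apply.
have [|wCN] := boolP (w \in C :|: N); first by move=> h;
  rewrite r_sym rCN // e_sym.
have [|Z [cZ ZN clZ jZ]] := extN [set u; w]; first by rewrite cards2;
  case: (_ != _); lia.
have rZ x : x \in [set u; w] -> {in Z, forall z, r x z}.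
  move=> xuw z zZ; rewrite r_sym rCN //; first
    by rewrite inE (subsetP ZN) ?orbT.
  by rewrite e_sym jZ.
apply: (cH Z u w) => //.
- exact: rclN.
- by apply: notin_nbr => z; apply: jZ; rewrite !inE eqxx.
- by apply: notin_nbr => z; apply: jZ; rewrite !inE eqxx orbT.
- exact: e_neq.
- by apply: rZ; rewrite set21.
- by apply: rZ; rewrite set22.
Qed.

(** * Lower bound: polynomials and interpolation *)

Local Open Scope ring_scope.

(** The values of the functionals on the standard basis form a matrix with trivial left kernel, so
    it has at least as many columns as rows. *)
Lemma leq_dim_separating (F : fieldType) (m n : nat) (I : finType)
    (phi : I -> {scalar 'M[F]_(m, n)}) :
  (forall M, (forall i, phi i M = 0) -> M = 0) -> (m * n <= #|I|)%N.
Proof.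
move=> sep.
pose A := \matrix_(k < m * n, j < #|I|) phi (enum_val j) (vec_mx (delta_mx 0
  k)).
suff /eqP <- : row_free A by exact: rank_leq_col.
apply: inj_row_free => v vA; apply: (can_inj vec_mxK); rewrite linear0.
apply: sep => i; rewrite [v]row_sum_delta !linear_sum /=.
have /matrixP/(_ 0 (enum_rank i)) := vA; rewrite !mxE => vAi.
rewrite -[RHS]vAi; apply: eq_bigr => k _.
by rewrite !linearZ /= mxE enum_rankK.
Qed.

(* Row x of M holds the coefficients of a polynomial of degree less than d,
   which is evaluated at the point enum_rank y attached to y. *)
Definition eval_row (V : finType) (d : nat) (x y : V) (M : 'M[rat]_(#|V|, d))
    : rat :=
  (M *m Vandermonde d (\row_j (j : nat)%:R)) (enum_rank x) (enum_rank y).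

Fact eval_row_is_scalar (V : finType) (d : nat) (x y : V) :
  scalar (@eval_row V d x y).
Proof. by move=> a M M'; rewrite /eval_row mulmxDl -scalemxAl !mxE. Qed.

HB.instance Definition _ (V : finType) (d : nat) (x y : V) :=
  GRing.isLinear.Build rat 'M[rat]_(#|V|, d) rat *%R (@eval_row V d x y)
    (@eval_row_is_scalar V d x y).

Lemma Vandermonde_unit (F : fieldType) (d : nat) (a : 'rV[F]_d) :
  injective (a 0) -> Vandermonde d a \in unitmx.
Proof.
move=> a_inj; rewrite unitmxE det_Vandermonde unitfE.
apply/prodf_neq0 => i _; apply/prodf_neq0 => j ij.
by rewrite subr_eq0; apply: contraTneq ij => /a_inj ->; rewrite ltnn.
Qed.

Lemma rank_points_unit (V : finType) (d : nat) (c : 'I_d -> V) :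
  injective c ->
  Vandermonde d (\row_j (enum_rank (c j) : nat)%:R : 'rV[rat]_d) \in unitmx.
Proof.
move=> c_inj; apply: Vandermonde_unit => i j; rewrite !mxE => /eqP.
by rewrite eqr_nat => /eqP/ord_inj/enum_rank_inj/c_inj.
Qed.

Lemma eval_row_points (V : finType) (d : nat) (c : 'I_d -> V) x j
    (M : 'M[rat]_(#|V|, d)) :
  (M *m Vandermonde d (\row_j (enum_rank (c j) : nat)%:R)) (enum_rank x) j
  = eval_row x (c j) M.
Proof. by rewrite /eval_row !mxE; apply: eq_bigr => k _; rewrite !mxE. Qed.

(** Lagrange interpolation at the points of [c]; the coefficients [L] depend neither on [M] nor on
    the row. *)
Lemma eval_row_interpolation (V : finType) (d : nat) (c : 'I_d -> V) :
  injective c -> exists L : 'I_d -> V -> rat,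
    forall (M : 'M_(#|V|, d)) x y,
    eval_row x y M = \sum_j eval_row x (c j) M * L j y.
Proof.
move=> c_inj.
set W := Vandermonde d (\row_j (enum_rank (c j) : nat)%:R : 'rV[rat]_d).
have uW : W \in unitmx := rank_points_unit c_inj.
exists (fun j y => (invmx W *m Vandermonde d (\row_j (j : nat)%:R))
  j (enum_rank y)) => M x y.
rewrite {1}/eval_row -[M in LHS](mulmxK uW) -(mulmxA (M *m W)) mxE.
by apply: eq_bigr => j _; rewrite -eval_row_points.
Qed.

Lemma eval_row_eq0 (V : finType) (d : nat) (c : 'I_d -> V)
    (M : 'M[rat]_(#|V|, d)) :
  injective c -> (forall x j, eval_row x (c j) M = 0) -> M = 0.
Proof.
move=> c_inj M0; rewrite -[M](mulmxK (rank_points_unit c_inj)).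
set A := M *m _; suff -> : A = 0 by rewrite mul0mx.
apply/matrixP => i j; rewrite -(enum_valK i) eval_row_points M0 mxE //.
Qed.

(** Interpolating twice at [Y] turns f_u(t_w) into the double sum of f_i(t_j) L_j(u) L_i(w) over i,
    j in [Y]. The symmetry of f_i(t_j) on [Y] makes it symmetric in u and w. *)
Lemma eval_row_near_clique_closed (V : finType) (d : nat) (e : rel V)
    (M : 'M[rat]_(#|V|, d)) :
  near_clique_closed d e (fun x y => eval_row x y M == eval_row y x M).
Proof.
(* Replacing [d] by the cardinal of [Y] lets [enum_val] list the interpolation points. *)
move=> Y u w _ cY; case: {d} _ / cY M => M /cliqueP clY uY wY uw uP wP.
have [L LP] := eval_row_interpolation (@enum_val_inj _ (mem Y)).
apply/eqP; rewrite LP [RHS]LP.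
under eq_bigr => j _ do rewrite (eqP (uP _ (enum_valP j))) LP mulr_suml.
under [RHS]eq_bigr => j _ do rewrite (eqP (wP _ (enum_valP j))) LP mulr_suml.
rewrite exchange_big; apply: eq_bigr => i _; apply: eq_bigr => j _.
rewrite mulrAC; congr (_ * _ * _); have [->//|ij] := eqVneq i j.
by apply/eqP/clY; rewrite ?enum_valP // (inj_eq enum_val_inj) eq_sym.
Qed.

Lemma wsat_lower (V : finType) (d : nat) (e : rel V) :
  (d <= #|V|)%N ->
  (forall u w, exists Y : {set V},
     #|Y| = d /\ clique_extension e [set u; w] Y) ->
  (d * #|V| <= wsat e d.+2 + 'C(d.+1, 2))%N.
Proof.
move=> dV ext;
  have [F /and3P[sF _ cF] ->] := wsat_attained e (isT : (2 <= d.+2)%N).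
pose c (i : 'I_d) : V := enum_val (widen_ord dV i).
have c_inj : injective c by move=> i j /enum_val_inj/(congr1 val) ij;
  apply: val_inj.
have /fin_all_exists[ends endsP] (f : {f | f \in F}) :
    exists p : V * V, val f = [set p.1; p.2].
  by have /edgesP[u [w [_ E]]] := subsetP sF _ (valP f); exists (u, w).
(* One functional per edge of [F], with an arbitrary orientation, and one per pair j <= i of indices
   of the fixed d-set, diagonal included: C(d+1,2) pairs. *)
pose I : finType := ({f | f \in F} + {i : 'I_d & 'I_i.+1})%type.
pose phi (k : I) : {scalar 'M[rat]_(#|V|, d)} := match k with
  | inl f => eval_row (ends f).1 (ends f).2 \- eval_row (ends f).2 (ends f).1
  | inr ij =>
      eval_row (c (tag ij)) (c (widen_ord (ltn_ord (tag ij)) (tagged ij)))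
  end.
have <- : #|I| = (#|F| + 'C(d.+1, 2))%N.
  rewrite card_sum card_sig; congr (_ + _)%N; rewrite card_tagged.
  rewrite sumnE big_map big_enum /= -bin2_sum big_nat_recl // add0n big_mkord.
  by apply: eq_bigr => i _; rewrite card_ord.
rewrite mulnC; apply: (@leq_dim_separating _ _ _ _ phi) => M phi0.
pose r : rel V := fun x y => eval_row x y M == eval_row y x M.
have r_sym : symmetric r by move=> x y; rewrite /r eq_sym.
have er : edges e \subset edges r.
  apply: (closed_completable cF).
    apply/subsetP => f fF; have := endsP (Sub f fF) => /= Ef.
    apply/edgesP; exists (ends (Sub f fF)).1, (ends (Sub f fF)).2; split=> //.
    by have /eqP := phi0 (inl (Sub f fF)); rewrite /= subr_eq0.
  apply/near_clique_closedP => Y u w; rewrite !(edge_rel_edges r_sym).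
  move=> euw cY /cliqueP clY uY wY uw uP wP.
  apply: (eval_row_near_clique_closed euw cY) => //.
  - by apply/cliqueP => x y xY yY xy; rewrite -/(r x y) -edge_rel_edges // clY.
  - by move=> y /uP; rewrite edge_rel_edges.
  - by move=> y /wP; rewrite edge_rel_edges.
have {}er u w : e u w -> r u w.
  move=> euw; rewrite -edge_rel_edges //; apply: (subsetP er).
  by apply/edgesP; exists u, w.
(* A pair that may be a nonedge of G is handled by taking the always true relation for [e]; the
   edges to the clique extension [Y] lie in G. *)
have rT u w : r u w.
  have [->|uw] := eqVneq u w; first by rewrite /r eqxx.
  have [Y [cY /clique_extensionP[dY /cliqueP clY jY]]] := ext u w.
  have uY := disjointFr dY (set21 u w); have wY := disjointFr dY (set22 u w).
  apply: (@eval_row_near_clique_closed _ _ (fun _ _ => true) _ Y) => //.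
  - by apply/cliqueP => x y xY yY xy; apply/er/clY.
  - by rewrite uY.
  - by rewrite wY.
  - by move=> y yY; apply/er/jY; rewrite ?set21.
  - by move=> y yY; apply/er/jY; rewrite ?set22.
have c0 i j : eval_row (c i) (c j) M = 0.
  wlog ji : i j / (j <= i)%N.
    by move=> h; case: (leqP j i) => [|/ltnW] /h // <-; apply/eqP/rT.
  have := phi0 (inr (Tagged (fun i : 'I_d => 'I_i.+1)
    (Ordinal (ji : (j < i.+1)%N)))).
  by rewrite /=; congr (eval_row _ (c _) _ = _); apply: val_inj.
have [L LP] := eval_row_interpolation c_inj.
(* By symmetry f_x at c_j equals f_(c_j) at x, and f_(c_j) vanishes at all d points of [c]. *)
apply: (eval_row_eq0 c_inj) => x j; rewrite (eqP (rT _ _)) LP big1 // => k _.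
by rewrite c0 mul0r.
Qed.

Theorem theorem3p3 (R : realType) (s : nat) (gamma : R) (V : finType)
    (e : rel V) (e_sym : symmetric e) (e_irr : irreflexive e) :
  (3 <= s)%N -> 0 < gamma -> good (2 * s) gamma e ->
  (wsat e s)%:Z = (s%:Z - 2) * #|V|%:Z - ('C(s - 1, 2))%:Z.
Proof.
case: s => [|[|d]] // _ gamma_gt0 [P1 P2].
(* On an empty vertex set, (P2) would yield a vertex of the empty set. *)
have V_gt0 : (0 < #|V|)%N.
  rewrite lt0n; apply/negP => /eqP V0; have := P2 set0 set0.
  rewrite V0 mulr0 mul0r cards0 lexx => /(_ _ isT isT)[|v [X [] //]].
    by rewrite disjoints_subset sub0set.
  by rewrite inE.
have ext (X : {set V}) : (#|X| <= (d.+1).*2)%N ->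
    exists Y : {set V}, #|Y| = d /\ clique_extension e X Y.
  (* Since gamma n > 0, the family given by (P1) has at least one member. *)
  move=> leX; have [||[|k] [Y [le_k YP _]]] := P1 X d; [lia|lia| |].
    by move: le_k; rewrite leNgt mulr_gt0 ?ltr0n.
  by exists (Y ord0).
have dV : (d <= #|V|)%N.
  by have [|C [<- _]] := ext set0; rewrite ?cards0 ?max_card.
have lower : (d * #|V| <= wsat e d.+2 + 'C(d.+1, 2))%N.
  apply: wsat_lower => // u w; apply: ext; rewrite cards2; lia.
have upper := wsat_upper e_sym e_irr ext.
have -> : d.+2%:Z - 2 = d%:Z by lia.
rewrite subSS subn0 -PoszM; apply/eqP; rewrite eq_sym subr_eq -PoszD.
by apply/eqP; congr Posz; apply/eqP; rewrite eqn_leq lower upper.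
Qed.
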